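(* Let $F_{3,1}\colon M_1\to M_1$ be the scalar dilation of the three-dimensional integral Heisenberg nilmanifold induced by $(u,v,c)\mapsto(3u,3v,9c)$. Then $$\mathcal V_{F_{3,1}}(8)=5.$$ Since $N(F_{3,1})=32$, the visible class count need not divide the Nielsen number. In particular, the profile $B\mapsto\mathcal V_{F_{3,1}}(B)$ is not a toral divisor staircase, i.e. not of the form $B\mapsto\max\{d:d\mid D,\ d\le B\}$ for a positive integer $D$.
   Context: Heisenberg nilmanifold. $\mathbb H_1(\mathbb Z)=\mathbb Z\times\mathbb Z\times\mathbb Z$ with $(u,v,c)(u',v',c')=(u+u',v+v',c+c'-u'v)$; $\mathbb H_1(\mathbb R)$ is defined by the same formula over $\mathbb R$, and $M_1=\mathbb H_1(\mathbb Z)\backslash\mathbb H_1(\mathbb R)$. The given endomorphism preserves the lattice and induces $F_{3,1}$. General definitions. For a self-map $f\colon X\to X$ of a finite connected CW complex, $G=\pi_1(X,x_0)$, a choice of lift $\tilde f$ of $f$ to the universal cover $p\colon\tilde X\to X$ determines $\phi\in\mathrm{End}(G)$ with $\tilde f(g\tilde x)=\phi(g)\tilde f(\tilde x)$. Write $a\sim_\phi b$ if $b=ga\phi(g)^{-1}$ for some $g\in G$; $\mathcal R(\phi)$ is the set of classes. The Reidemeister trace is $\mathrm{RT}(f)=\sum_{\alpha}I_f(\alpha)[\alpha]\in\mathbb Z[\mathcal R(\phi)]$, where for $\alpha=[a]$, $I_f(\alpha)$ is the fixed-point index of the fixed-point class $p(\mathrm{Fix}(a\tilde f))$; it has finite support,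 and $N(f)=\#\mathrm{supp}\,\mathrm{RT}(f)$ is the Nielsen number. A finite observer is a finite-index normal subgroup $N\triangleleft G$ with $\phi(N)\subseteq N$; with $q_N\colon G\to G/N$ and induced $\bar\phi_N$, it gives $(q_N)_R\colon\mathcal R(\phi)\to\mathcal R(\bar\phi_N)$, $[a]\mapsto[q_N(a)]$, and the observed trace $\mathrm{RT}_N(f)$ is the pushforward of $\mathrm{RT}(f)$ along $(q_N)_R$. Put $V_N(f)=\#\mathrm{supp}\,\mathrm{RT}_N(f)$ (visible class count). For $B\in\mathbb N$, the visibility profile $\mathcal V_f(B)$ is the maximum of $V_N(f)$ over finite observers $N$ with $[G:N]\le B$. *)

(* Defs.v *)
From HB Require Import structures.
From mathcomp Require Import all_boot all_order all_algebra.
From mathcomp Require Import finmap.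
From mathcomp Require Import all_classical all_reals all_analysis.
From mathcomp Require Import ring.

Set Implicit Arguments.
Unset Strict Implicit.
Unset Printing Implicit Defensive.
Import Order.TTheory GRing.Theory Num.Theory.
Import numFieldNormedType.Exports.

Local Open Scope classical_set_scope.
Local Open Scope ring_scope.
Local Open Scope quotient_scope.

Notation "{ 'ghom' G -> H }" := (monoid.UMagmaMorphism.type G H)
  (at level 0, G at level 98, H at level 99, format "{ 'ghom'  G  ->  H }")
  : type_scope.

(** * Reidemeister classes *)

Section Reidemeister.
Local Open Scope group_scope.
Context {G : groupType} (phi : {ghom G -> G}).

Definition twisted_conj (a b : G) : bool :=
  `[< exists g : G, b = g * a * (phi g)^-1 >].

Lemma twisted_conj_refl : reflexive twisted_conj.
Proof. by move=> a; apply/asboolP; exists 1; rewrite gmulf1 invg1 mulg1 mul1g. Qed.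

Lemma twisted_conj_sym : symmetric twisted_conj.
Proof.
have H a b : twisted_conj a b -> twisted_conj b a.
  move=> /asboolP[g ->]; apply/asboolP; exists g^-1.
  by rewrite gmulfV invgK !mulgA mulVg mul1g -mulgA mulVg mulg1.
by move=> a b; apply/idP/idP; apply: H.
Qed.

Lemma twisted_conj_trans : transitive twisted_conj.
Proof.
move=> b a c /asboolP[g ->] /asboolP[h ->]; apply/asboolP; exists (h * g).
by rewrite gmulfM invgM !mulgA.
Qed.

Canonical twisted_conj_equiv :=
  EquivRel twisted_conj twisted_conj_refl twisted_conj_sym twisted_conj_trans.

Definition reidemeister := {eq_quot twisted_conj_equiv}.
HB.instance Definition _ := Choice.on reidemeister.

Definition rclass (a : G) : reidemeister := \pi_{eq_quot twisted_conj_equiv} a.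

(* an inhabitant of the class [a] *)
Definition rrepr (alpha : reidemeister) : G :=
  repr (alpha : {eq_quot twisted_conj_equiv}).

End Reidemeister.

(** * Elements of [Z[S]], as functions with finite support *)

Definition supp {S : choiceType} (c : S -> int) : set S := [set s | c s != 0].

Definition supp_card {S : choiceType} (c : S -> int) : nat :=
  #|` fset_set (supp c)|%fset.

Definition pushforward {S T : choiceType} (h : S -> T) (c : S -> int) : T -> int :=
  fun t => \sum_(s \in h @^-1` [set t]) c s.

(** * Quotient groups of a possibly infinite group *)

Record normal_subgroup (G : groupType) := NormalSubgroup {
  nsub :> set G;
  nsub1 : nsub 1%g;
  nsubM : forall x y, nsub x -> nsub y -> nsub (x * y)%g;
  nsubV : forall x, nsub x -> nsub (x^-1)%g;
  nsubJ : forall x g, nsub x -> nsub (g * x * g^-1)%g }.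

Section QuotientGroup.
Local Open Scope group_scope.
Context {G : groupType} (N : normal_subgroup G).

Definition same_coset (x y : G) : bool := `[< nsub N (x^-1 * y) >].

Lemma same_coset_refl : reflexive same_coset.
Proof. by move=> x; apply/asboolP; rewrite mulVg; exact: nsub1. Qed.

Lemma same_coset_sym : symmetric same_coset.
Proof.
have H a b : same_coset a b -> same_coset b a.
  by move=> /asboolP/nsubV; rewrite invgM invgK => ?; apply/asboolP.
by move=> a b; apply/idP/idP; apply: H.
Qed.

Lemma same_coset_trans : transitive same_coset.
Proof.
move=> b a c /asboolP ab /asboolP bc; apply/asboolP.
by have := nsubM ab bc; rewrite !mulgA mulgK.
Qed.

Canonical same_coset_equiv :=
  EquivRel same_coset same_coset_refl same_coset_sym same_coset_trans.

Definition quotient_group := {eq_quot same_coset_equiv}.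
HB.instance Definition _ := Choice.on quotient_group.

Definition qproj (x : G) : quotient_group := \pi_{eq_quot same_coset_equiv} x.
Definition qrepr (q : quotient_group) : G :=
  repr (q : {eq_quot same_coset_equiv}).

Lemma qreprK q : qproj (qrepr q) = q.
Proof. exact: reprK. Qed.

Lemma qprojP x y : qproj x = qproj y <-> nsub N (x^-1 * y).
Proof.
split=> [|H]; first by move/eqP; rewrite /qproj eqmodE => /asboolP.
by apply/eqP; rewrite /qproj eqmodE; apply/asboolP.
Qed.

Definition qmul (p q : quotient_group) := qproj (qrepr p * qrepr q).
Definition qinv (q : quotient_group) := qproj (qrepr q)^-1.

Lemma qmulE x y : qmul (qproj x) (qproj y) = qproj (x * y).
Proof.
apply/qprojP; set x' := qrepr _; set y' := qrepr _.
have Hx : nsub N (x'^-1 * x) by apply/qprojP; rewrite qreprK.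
have Hy : nsub N (y'^-1 * y) by apply/qprojP; rewrite qreprK.
have := nsubM (nsubJ y'^-1 Hx) Hy.
by rewrite invgK invgM !mulgA mulgK.
Qed.

Lemma qinvE x : qinv (qproj x) = qproj x^-1.
Proof.
apply/qprojP; set x' := qrepr _; rewrite invgK.
have Hx : nsub N (x^-1 * x') by apply/qprojP; rewrite qreprK.
by have := nsubJ x Hx; rewrite !mulgA mulgV mul1g.
Qed.

Lemma qmulA : associative qmul.
Proof.
move=> a b c; rewrite -(qreprK a) -(qreprK b) -(qreprK c).
by rewrite !qmulE mulgA.
Qed.

Lemma qmul1g : left_id (qproj 1) qmul.
Proof. by move=> a; rewrite -(qreprK a) qmulE mul1g. Qed.

Lemma qinvK : involutive qinv.
Proof. by move=> a; rewrite -(qreprK a) !qinvE invgK. Qed.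

Lemma qinvM : {morph qinv : x y / qmul x y >-> qmul y x}.
Proof.
move=> a b; rewrite -(qreprK a) -(qreprK b).
by rewrite qmulE !qinvE qmulE invgM.
Qed.

Lemma qmulVg : left_inverse (qproj 1) qinv qmul.
Proof. by move=> a; rewrite -(qreprK a) qinvE qmulE mulVg. Qed.

HB.instance Definition _ :=
  isStarMonoid.Build quotient_group qmulA qmul1g qinvK qinvM.
HB.instance Definition _ := StarMonoid_isGroup.Build quotient_group qmulVg.

Lemma qprojM : {morph qproj : x y / x * y}.
Proof. by move=> x y; rewrite [RHS]qmulE. Qed.

Lemma qprojV : {morph qproj : x / x^-1}.
Proof. by move=> x; rewrite [RHS]qinvE. Qed.

End QuotientGroup.

(** * Finite observers, observed traces and the visibility profile *)

Record finite_observer (G : groupType) (phi : {ghom G -> G}) :=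
  FiniteObserver {
    observer_sub :> normal_subgroup G;
    observer_finite : finite_set [set: quotient_group observer_sub];
    observer_stable : forall x, nsub observer_sub x -> nsub observer_sub (phi x) }.

Section Observers.
Context {G : groupType} (phi : {ghom G -> G}).

Section OneObserver.
Variable N : finite_observer phi.

Definition observer_index : nat :=
  #|` fset_set [set: quotient_group N]|%fset.

Definition observed_map (q : quotient_group N) : quotient_group N :=
  qproj N (phi (qrepr q)).

Lemma observed_mapE x : observed_map (qproj N x) = qproj N (phi x).
Proof.
apply/qprojP; rewrite -gmulfV -gmulfM; apply: observer_stable.
by apply/qprojP; rewrite qreprK.
Qed.

Lemma observed_map_morph : monoid.monoid_morphism observed_map.
Proof.
split=> [|a b]; first by rewrite [LHS]observed_mapE gmulf1.
by rewrite -(qreprK a) -(qreprK b) -qprojM !observed_mapE gmulfM qprojM.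
Qed.

HB.instance Definition _ := isUMagmaMorphism.Build
  (quotient_group N) (quotient_group N) observed_map observed_map_morph.

(* well defined on classes, see observer_mapE *)
Definition observer_map (alpha : reidemeister phi) : reidemeister observed_map :=
  rclass observed_map (qproj N (rrepr alpha)).

Lemma observer_mapE (a : G) :
  observer_map (rclass phi a) = rclass observed_map (qproj N a).
Proof.
have : twisted_conj phi (rrepr (rclass phi a)) a.
  by apply/eqmodP; rewrite /rrepr reprK.
move=> /asboolP[g ga]; apply/eqmodP; apply/asboolP; exists (qproj N g).
by rewrite {1}ga !qprojM qprojV -observed_mapE.
Qed.

Definition observed_trace (RT : reidemeister phi -> int) :
  reidemeister observed_map -> int := pushforward observer_map RT.

Definition visible_class_count (RT : reidemeister phi -> int) : nat :=
  supp_card (observed_trace RT).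

End OneObserver.

(* the maximum of a nonempty bounded set of naturals (0 by default) *)
Definition nat_max (A : set nat) : nat :=
  xget 0%N [set m | A m /\ forall k, A k -> (k <= m)%N].

Definition visibility_profile (RT : reidemeister phi -> int) (B : nat) : nat :=
  nat_max [set m | exists2 N : finite_observer phi,
    (observer_index N <= B)%N & m = visible_class_count N RT].

End Observers.

(** * Brouwer degree and fixed-point index *)

Section Degree.
Context {R : realType} {n : nat}.
Implicit Types (g h : 'rV[R]_n -> 'rV[R]_n) (U : set 'rV[R]_n) (x : 'rV[R]_n).

Definition boundary U : set 'rV[R]_n := closure U `\` interior U.

(* g is continuous on the closure of U and C^1 on U, does not vanish on the
   boundary of U, and has 0 as a regular value on U *)
Definition zero_regular g U : Prop :=
  [/\ {within closure U, continuous g},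
      forall x, U x -> differentiable g x /\ {for x, continuous (jacobian g)},
      forall x, boundary U x -> g x != 0
    & forall x, U x -> g x = 0 -> \det ('J g x) != 0].

Definition regular_degree g U : int :=
  \sum_(x \in [set x | U x /\ g x = 0]) sgz (\det ('J g x)).

(* The Brouwer degree deg(g, U, 0), for U bounded open and g continuous on the
   closure of U without zeros on the boundary, by the usual two stages: the sum
   of the signs of the Jacobians when 0 is a regular value, and otherwise the
   common value of these sums for the maps h satisfying zero_regular that are
   closer to g than the distance from 0 to the image of the boundary. *)
Definition brouwer_degree g U : int :=
  if pselect (zero_regular g U) then regular_degree g U
  else xget 0 [set d | exists h (e : R),
    [/\ zero_regular h U,
        forall x, boundary U x -> e <= `|g x|,
        forall x, closure U x -> `|g x - h x| < e
      & d = regular_degree h U]].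

(* index of g at an isolated fixed point x: the degree of id - g on small balls *)
Definition euclidean_index g x : int :=
  xget 0 [set d | \forall e \near 0^'+,
    brouwer_degree (fun y => y - g y) (ball x e) = d].

End Degree.

(** * Reidemeister trace of a self-map of a space covered by [R^n] *)

Section ReidemeisterTrace.
Context {R : realType} {n : nat}.
(* p is the universal cover, act the action of G by deck transformations *)
Context {X : choiceType} (p : 'rV[R]_n -> X).
Context {G : groupType} (act : G -> 'rV[R]_n -> 'rV[R]_n).
Variable f : X -> X.

(* The local inverses of p are charts of X. In such a chart around a fixed point
   y = p x of f, the map f reads as a map g that fixes x and satisfies
   p \o g = f \o p near x; the germ of g at x is determined by f and x, and
   another x in the fiber of y gives a germ conjugate to it. *)
Definition fixed_point_index (y : X) : int :=
  xget 0 [set d | exists x g,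
    [/\ p x = y, g x = x,
        \forall z \near x, {for z, continuous g} /\ p (g z) = f (p z)
      & d = euclidean_index g x]].

Variables (ft : 'rV[R]_n -> 'rV[R]_n) (phi : {ghom G -> G}).

Definition fixed_point_class (a : G) : set X :=
  p @` [set x | act a (ft x) = x].

(* The index of a fixed-point class consisting of finitely many points, each
   isolated among the fixed points of f, is the sum of the indices at these
   points. The class depends only on [a], so any representative will do. *)
Definition reidemeister_trace (alpha : reidemeister phi) : int :=
  \sum_(y \in fixed_point_class (rrepr alpha)) fixed_point_index y.

Definition nielsen_number : nat := supp_card reidemeister_trace.

Definition is_lift : Prop := continuous ft /\ forall x, p (ft x) = f (p x).

Definition lift_compatible : Prop :=
  forall g x, ft (act g x) = act (phi g) (ft x).

End ReidemeisterTrace.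

(** * The Heisenberg nilmanifold [M_1] and the map [F_{3,1}] *)

Section Heisenberg.
Context {R : comNzRingType}.

Definition vec3 (u v c : R) : 'rV[R]_3 := \row_i [:: u; v; c]`_i.

Lemma vec3P (x : 'rV[R]_3) : vec3 (x 0 0) (x 0 1) (x 0 2) = x.
Proof.
apply/rowP => i; rewrite mxE; case: i => -[|[|[|//]]] Hi /=;
  by congr (x _ _); apply/val_inj.
Qed.

Lemma vec3E u v c :
  (vec3 u v c 0 0 = u) * (vec3 u v c 0 1 = v) * (vec3 u v c 0 2 = c).
Proof. by rewrite !mxE. Qed.

End Heisenberg.

Definition heis (R : comNzRingType) : Type := 'rV[R]_3.
HB.instance Definition _ (R : comNzRingType) := Choice.on (heis R).

Section HeisenbergGroup.
Context {R : comNzRingType}.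
Implicit Types x y z : heis R.

Definition heis_mul x y : heis R :=
  vec3 (x 0 0 + y 0 0) (x 0 1 + y 0 1) (x 0 2 + y 0 2 - y 0 0 * x 0 1).
Definition heis_one : heis R := vec3 0 0 0.
Definition heis_inv x : heis R :=
  vec3 (- x 0 0) (- x 0 1) (- x 0 2 - x 0 0 * x 0 1).

Lemma heis_mulA : associative heis_mul.
Proof. by move=> x y z; congr vec3; rewrite !vec3E; ring. Qed.

Lemma heis_mul1 : left_id heis_one heis_mul.
Proof. by move=> x; rewrite -[RHS]vec3P; congr vec3; rewrite !vec3E; ring. Qed.

Lemma heis_invK : involutive heis_inv.
Proof. by move=> x; rewrite -[RHS]vec3P; congr vec3; rewrite !vec3E; ring. Qed.

Lemma heis_invM : {morph heis_inv : x y / heis_mul x y >-> heis_mul y x}.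
Proof. by move=> x y; congr vec3; rewrite !vec3E; ring. Qed.

Lemma heis_mulV : left_inverse heis_one heis_inv heis_mul.
Proof. by move=> x; congr vec3; rewrite !vec3E; ring. Qed.

HB.instance Definition _ :=
  isStarMonoid.Build (heis R) heis_mulA heis_mul1 heis_invK heis_invM.
HB.instance Definition _ := StarMonoid_isGroup.Build (heis R) heis_mulV.

Definition dilation3 (x : 'rV[R]_3) : 'rV[R]_3 :=
  vec3 (3 * x 0 0) (3 * x 0 1) (9 * x 0 2).

Lemma dilation3_morph : {morph dilation3 : x y / ((x : heis R) * y)%g}.
Proof. by move=> x y; congr vec3; rewrite !vec3E; ring. Qed.

Definition heis_dilation3 : heis R -> heis R := dilation3.

Fact heis_dilation3_monoid_morphism : monoid.monoid_morphism heis_dilation3.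
Proof.
by split; [congr vec3; rewrite !vec3E mulr0 | exact: dilation3_morph].
Qed.
HB.instance Definition _ := isUMagmaMorphism.Build
  (heis R) (heis R) heis_dilation3 heis_dilation3_monoid_morphism.

End HeisenbergGroup.

Section Nilmanifold.
Context {R : realType}.

Definition deck (g : heis int) (x : 'rV[R]_3) : 'rV[R]_3 :=
  ((map_mx intr g : heis R) * (x : heis R))%g.

Lemma deckE g x : deck g x =
  vec3 ((g 0 0)%:~R + x 0 0) ((g 0 1)%:~R + x 0 1)
       ((g 0 2)%:~R + x 0 2 - x 0 0 * (g 0 1)%:~R).
Proof. by congr vec3; rewrite !mxE. Qed.

Lemma deck1 x : deck 1%g x = x.
Proof. by rewrite deckE -[RHS]vec3P; congr vec3; rewrite !vec3E /=; ring. Qed.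

Lemma deckM g h x : deck (g * h)%g x = deck g (deck h x).
Proof.
rewrite !deckE; congr vec3; rewrite !vec3E ?(intrD, rmorphB, rmorphM) /=; ring.
Qed.

Definition same_orbit (x y : 'rV[R]_3) : bool :=
  `[< exists g : heis int, y = deck g x >].

Lemma same_orbit_refl : reflexive same_orbit.
Proof. by move=> x; apply/asboolP; exists 1%g; rewrite deck1. Qed.

Lemma same_orbit_sym : symmetric same_orbit.
Proof.
have H x y : same_orbit x y -> same_orbit y x.
  move=> /asboolP[g ->]; apply/asboolP; exists (g^-1)%g.
  by rewrite -deckM mulVg deck1.
by move=> x y; apply/idP/idP; apply: H.
Qed.

Lemma same_orbit_trans : transitive same_orbit.
Proof.
move=> y x z /asboolP[g ->] /asboolP[h ->]; apply/asboolP; exists (h * g)%g.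
by rewrite deckM.
Qed.

Canonical same_orbit_equiv :=
  EquivRel same_orbit same_orbit_refl same_orbit_sym same_orbit_trans.

Definition M1 : topologicalType := quotient_topology {eq_quot same_orbit_equiv}.

Definition M1_proj (x : 'rV[R]_3) : M1 := \pi_{eq_quot same_orbit_equiv} x.
Definition M1_repr (y : M1) : 'rV[R]_3 :=
  repr (y : {eq_quot same_orbit_equiv}).

Lemma M1_projP x y : M1_proj x = M1_proj y <-> exists g, y = deck g x.
Proof.
have H : x = y %[mod {eq_quot same_orbit_equiv}] <-> exists g, y = deck g x.
  by split=> [/eqmodP/asboolP|?] //; apply/eqmodP/asboolP.
exact: H.
Qed.

Definition F31 (y : M1) : M1 := M1_proj (dilation3 (M1_repr y)).

Lemma dilation3_deck g (x : 'rV[R]_3) :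
  dilation3 (deck g x) = deck (dilation3 g) (dilation3 x).
Proof.
rewrite !deckE /dilation3; congr vec3; rewrite !vec3E ?(intrD, rmorphM) /=; ring.
Qed.

Lemma F31E x : F31 (M1_proj x) = M1_proj (dilation3 x).
Proof.
have /M1_projP[g xg] : M1_proj (M1_repr (M1_proj x)) = M1_proj x by exact: reprK.
by apply/M1_projP; exists (dilation3 g); rewrite {1}xg dilation3_deck.
Qed.

Lemma dilation3_continuous : continuous (@dilation3 R).
Proof.
pose k (j : 'I_3) : R := [:: 3; 3; 9]`_j.
have dE z i j : dilation3 z i j = k j * z i j.
  rewrite !mxE ord1 /k; case: j => -[|[|[|//]]] Hj /=;
    by congr (_ * z _ _); apply/val_inj.
move=> x A [P HP sub]; exists (fun i j => [set t | P i j (k j * t)]).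
  move=> i j; apply: (@mulrl_continuous _ (k j) (x i j)).
  by rewrite -dE; exact: HP.
by move=> z Hz; apply: sub => i j; rewrite dE; exact: Hz.
Qed.

Lemma F31_continuous : continuous F31.
Proof.
apply/quotient_continuous.
have -> : F31 \o \pi_M1 = M1_proj \o @dilation3 R.
  by apply/funext => x; exact: F31E.
move=> x; apply: continuous_comp; first exact: dilation3_continuous.
exact: pi_continuous.
Qed.

(* the dilation of H_1(R) is a lift of F31; the endomorphism it determines is
   the dilation of H_1(Z) *)
Lemma dilation3_lift : is_lift M1_proj F31 (@dilation3 R) /\
  lift_compatible deck (@dilation3 R)
    (heis_dilation3 : {ghom heis int -> heis int}).
Proof.
split; last exact: dilation3_deck.
by split=> [|x]; [exact: dilation3_continuous | rewrite F31E].
Qed.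

End Nilmanifold.
Arguments M1 : clear implicits.

(** * Toral divisor staircases *)

Definition divisor_staircase (D B : nat) : nat :=
  \max_(d < B.+1 | (d %| D)%N) d.

(* Main.v *)
Require Import Defs.
From HB Require Import structures.
From mathcomp Require Import all_boot all_order all_algebra.
From mathcomp Require Import finmap.
From mathcomp Require Import all_classical all_reals all_analysis.
From mathcomp Require Import zify ring lra.
Import numFieldNormedType.Exports.
Set Implicit Arguments.
Unset Strict Implicit.
Unset Printing Implicit Defensive.
Import Order.TTheory GRing.Theory Num.Theory.

Local Open Scope classical_set_scope.
Local Open Scope ring_scope.

(* The lattice acts freely and a lift of F_{3,1} is continuous, so every lift is
   x |-> h * D(x) with D the dilation and h a fixed lattice element; hence
   phi(g) = h D(g) h^-1. Each map x |-> a h * D(x) is affine with exactly one fixed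
   point, and the identity minus it has determinant (-2)(-2)(-8) < 0, so every
   Reidemeister class has index -1 and V_N is the number of phi-classes of G/N.
   For phi the classes are represented by (u, v, c) h^-1 with u, v mod 2 and
   c mod 8, which gives 32.
   If Q = G/N has n elements and s singleton classes, there are at most
   (n + s) / 2 classes. A singleton class {a} forces phi to be conjugation by a,
   so either s = 0, or Q is not abelian and s = #Z(Q) <= n / 4, or Q is abelian with
   phi = id, in which case Q is a quotient of (Z/2)^2. So V_N <= max(4, 5n/8), which
   is 5 for n = 8, attained by the elements with even coordinates, and 4 for n <= 5.
   A staircase with value 5 at 8 would already have value 5 at 5. *)

(** * Twisted conjugacy classes of finite quotients *)

Lemma in_fset_setT (T : choiceType) (x : T) :
  finite_set [set: T] -> x \in fset_set [set: T].
Proof. by move=> fT; rewrite in_fset_set // inE. Qed.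

Lemma card_fset_setT_le (T U : choiceType) (f : T -> U) :
  finite_set [set: T] -> (forall u, exists t, f t = u) ->
  finite_set [set: U] /\
  (#|` fset_set [set: U]| <= #|` fset_set [set: T]|)%N.
Proof.
move=> fT fsurj.
have im : [set: U] = f @` [set: T].
  by apply/seteqP; split=> // u _; have [t <-] := fsurj u; exists t.
by rewrite im fset_set_image //; split;
  [exact: finite_image | exact: leq_imfset_card].
Qed.

Lemma card_fset_setT_ge (T : finType) (U : choiceType) (f : T -> U) :
  finite_set [set: U] -> injective f -> (#|T| <= #|` fset_set [set: U]|)%N.
Proof.
move=> fU finj; rewrite cardfE.
apply: (leq_card (fun t => [` in_fset_setT (f t) fU]%fset)) => s t.
by move=> /(congr1 val)/finj.
Qed.

Lemma card_fset_setT (T : finType) : #|` fset_set [set: T]| = #|T|.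
Proof.
apply/eqP; rewrite eqn_leq.
rewrite (@card_fset_setT_ge T T id finite_finset (@inj_id _)) andbT cardfE.
exact: leq_card val_inj.
Qed.

(* A class that is not a singleton contains two distinct representatives. *)
Lemma card_classes (Q C : choiceType) (f : Q -> C) :
  finite_set [set: Q] -> (forall c, exists q, f q = c) ->
  ((#|` fset_set [set: C]|).*2 <= #|` fset_set [set: Q]| +
     #|` fset_set [set q | forall q', f q' = f q -> q' = q]|)%N.
Proof.
move=> fQ fsurj; set S := [set q | _].
have [fC _] := card_fset_setT_le fQ fsurj.
have /choice[r rK] := fsurj.
(* [t] picks a second element of the class where there is one, so the images of [r] and [t] can meet
   only in [S]. *)
have /choice[t tP] c : exists q, f q = c /\ (S q \/ q <> r c).
  have [Src|] := pselect (S (r c)); first by exists (r c); split; [|left].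
  move/existsNP => [q /not_implyP[fq nq]]; exists q.
  by rewrite fq rK; split=> //; right.
have tK c : f (t c) = c by have [] := tP c.
have rI : injective r by exact: can_inj rK.
have tI : injective t by exact: can_inj tK.
pose A := fset_set [set: C].
have <- : (#|` (r @` A)%fset| + #|` (t @` A)%fset| =
           (#|` A|).*2)%N.
  by rewrite !card_imfset //= addnn.
rewrite -cardfsUI leq_add // fsubset_leq_card //.
  by apply/fsubsetP => q _; exact: in_fset_setT.
apply/fsubsetP => q; rewrite inE => /andP[/imfsetP[c _ qc] /imfsetP[d _ qd]].
have cd : c = d by rewrite -(rK c) -qc qd tK.
have fS : finite_set S by exact: sub_finite_set fQ.
rewrite in_fset_set // inE qd; have [_ [//|]] := tP d.
by rewrite -qd qc cd.
Qed.

Lemma rclassP (G : groupType) (phi : {ghom G -> G}) (a b : G) :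
  rclass phi a = rclass phi b <-> exists g, (b = g * a * (phi g)^-1)%g.
Proof.
have H : a = b %[mod {eq_quot twisted_conj_equiv phi}]%qT <->
    exists g, (b = g * a * (phi g)^-1)%g.
  by split=> [/eqmodP/asboolP|?] //; apply/eqmodP/asboolP.
exact: H.
Qed.

Lemma rclass_surj (G : groupType) (phi : {ghom G -> G})
  (alpha : reidemeister phi) : exists a, rclass phi a = alpha.
Proof. by exists (rrepr alpha); exact: reprK. Qed.

(* If [a] is alone in its class then [phi] is conjugation by [a], so two such
   elements differ by a central one; in a nonabelian group the center has index
   at least 4. *)
Lemma card_reidemeister_le (Q : groupType) (phi : {ghom Q -> Q}) :
  finite_set [set: Q] ->
  let n := #|` fset_set [set: Q]| in
  let r := #|` fset_set [set: reidemeister phi]| in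
  [\/ (r.*2 <= n)%N, (8 * r <= 5 * n)%N
    | (forall x y : Q, x * y = y * x)%g /\ (forall x, phi x = x)].
Proof.
move=> fQ n r; have := card_classes fQ (@rclass_surj _ phi).
set S := [set q | _]; rewrite -/n -/r => le_r.
have conjS (a : Q) : S a -> forall g : Q, (g * a = a * phi g)%g.
  move=> Sa g; have /Sa/(canRL (mulgVK _)) :
      rclass phi (g * a * (phi g)^-1)%g = rclass phi a.
    by apply/esym/rclassP; exists g.
  by [].
have [[a Sa]|/forallNP nS] := pselect (exists a, S a); last first.
  apply: Or31; move: le_r; rewrite (_ : S = set0) ?fset_set0 ?cardfs0 ?addn0 //.
  by apply/seteqP; split.
have [Qab|] := pselect (forall x y : Q, x * y = y * x)%g.
  by apply: Or33; split=> // x; apply: (mulgI a); rewrite -conjS.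
move/existsNP => [x /existsNP[y xy]].
have fS : finite_set S by exact: sub_finite_set fQ.
(* The values 1, x, y, xy lie in distinct cosets of the center: which of [x] and [y] they commute
   with tells them apart. *)
pose e (b : bool * bool) := ((if b.1 then x else 1) * (if b.2 then y else 1))%g.
have commX b : commute x (e b) <-> ~~ b.2.
  case: b => -[] [] /=; rewrite /e /= ?(mulg1, mul1g); split=> //.
  - move=> H; exfalso; apply: xy; rewrite -[y](mulKg x).
    by apply/commuteM => //; exact/commuteV/commute_refl.
  - by move=> _; exact: commute1.
have commY b : commute y (e b) <-> ~~ b.1.
  case: b => -[] [] /=; rewrite /e /= ?(mulg1, mul1g); split=> //.
  - move=> H; exfalso; apply: xy; apply: commute_sym; rewrite -[x](mulgK y).
    by apply/commuteM => //; exact/commuteV/commute_refl.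
  - by move=> H; exfalso; apply: xy; apply: commute_sym.
  - by move=> _; exact: commute1.
pose S' := fset_set S.
have : (#|{: S' * (bool * bool)}| <= n)%N.
  apply: (@card_fset_setT_ge _ _
    (fun p : S' * (bool * bool) => val p.1 * e p.2)%g fQ).
  suff eI (a1 a2 : Q) b1 b2 : S a1 -> S a2 ->
      (a1 * e b1 = a2 * e b2)%g -> a1 = a2 /\ b1 = b2.
    move=> [a1 b1] [a2 b2] /= /eI[||/val_inj -> ->] //;
      by apply/set_mem; rewrite -(in_fset_set fS) fsvalP.
  move=> S1 S2 eq12.
  (* Conjugation by [a1] and by [a2] induces the same [phi], so [z] is central, and [e b1] and
     [e b2] commute with the same elements. *)
  pose z := (a1 * a2^-1)%g.
  have zC g : commute g z.
    rewrite /commute /z mulgA (conjS _ S1) -!mulgA; congr (_ * _)%g.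
    by apply: (mulgI a2); rewrite !mulgA mulgV mul1g -(conjS _ S2) mulgK.
  have e2 : e b2 = (z * e b1)%g.
    have -> : z = (a2^-1 * a1)%g.
      by apply: (mulgI a2); rewrite zC /z mulgA mulgV mul1g mulgVK.
    by rewrite -mulgA eq12 mulKg.
  have e1 : e b1 = (z^-1 * e b2)%g by rewrite e2 mulKg.
  have b12 : b1 = b2.
    have H g : commute g (e b1) <-> commute g (e b2).
      split=> H; [rewrite e2|rewrite e1]; apply: commuteM => //; exact/commuteV.
    move: (H x) (H y); rewrite !commX !commY.
    case: (b1) (b2) => [] [] [] [[] []] /= [h1 h2] [h3 h4] //;
       by [have := h1 isT|have := h2 isT|have := h3 isT|have := h4 isT].
  by move: eq12; rewrite b12 => /mulIg ->.
rewrite card_prod card_prod card_bool /S' -cardfE => le_S.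
by apply: Or32; move: le_r le_S; rewrite -/S; lia.
Qed.

(** * Maxima and visible classes for a trace constantly equal to -1 *)

Lemma nat_max_eq (A : set nat) m :
  A m -> (forall k, A k -> (k <= m)%N) -> nat_max A = m.
Proof.
move=> Am le_m; apply: xget_unique => // k [Ak le_k].
by apply/eqP; rewrite eqn_leq le_m // le_k.
Qed.

Lemma nat_max_le (A : set nat) b :
  (forall k, A k -> (k <= b)%N) -> (nat_max A <= b)%N.
Proof. by move=> le_b; rewrite /nat_max; case: xgetP => // k _ [/le_b]. Qed.

(** Fibers are finite and nonempty and all coefficients have the same sign, so nothing cancels. *)
Lemma supp_pushforward_N1 (S T : choiceType) (f : S -> T) :
  finite_set [set: S] -> (forall t, exists s, f s = t) ->
  supp (Defs.pushforward f (fun=> -1)) = [set: T].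
Proof.
move=> fS fsurj; apply/seteqP; split=> // t _; rewrite /supp /Defs.pushforward /=.
have fA : finite_set (f @^-1` [set t]) by exact: sub_finite_set fS.
rewrite (fsbig_finite _ _ fA) big_const_seq count_predT iter_addr_0.
rewrite mulrn_eq0 oppr_eq0 oner_eq0 orbF cardfs_eq0.
have [s fs] := fsurj t.
have sA : s \in fset_set (f @^-1` [set t]) by rewrite in_fset_set // inE.
by apply/eqP => A0; rewrite A0 in sA.
Qed.

Lemma observer_map_surj (G : groupType) (phi : {ghom G -> G})
    (N : finite_observer phi) (beta : reidemeister (@observed_map G phi N)) :
  exists alpha : reidemeister phi, @observer_map G phi N alpha = beta.
Proof.
have [q <-] := rclass_surj beta; exists (rclass phi (qrepr q)).
by rewrite observer_mapE qreprK.
Qed.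

Lemma visible_class_count_N1 (G : groupType) (phi : {ghom G -> G})
    (N : finite_observer phi) (RT : reidemeister phi -> int) :
  finite_set [set: reidemeister phi] -> (forall alpha, RT alpha = -1) ->
  visible_class_count N RT =
  #|` fset_set [set: reidemeister (@observed_map G phi N)]|.
Proof.
move=> fR RT1; rewrite (_ : RT = fun=> -1); last exact/funext.
rewrite /visible_class_count /supp_card supp_pushforward_N1 //.
exact: observer_map_surj.
Qed.

(** A twisting element of the quotient lifts to the group, so equality of observed classes becomes a
    congruence modulo [N] that coordinates can test. *)
Lemma observer_map_eqP (G : groupType) (phi : {ghom G -> G})
    (N : finite_observer phi) (a b : G) :
  @observer_map G phi N (rclass phi a) = @observer_map G phi N (rclass phi b) ->
  exists g, nsub N ((g * a * (phi g)^-1)^-1 * b)%g.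
Proof.
rewrite !observer_mapE => /rclassP[x abx]; exists (qrepr x).
by apply/qprojP; rewrite abx !qprojM qprojV -observed_mapE qreprK.
Qed.

(** * Finite observers of the Heisenberg dilation *)

Lemma vec3_inj (R : comNzRingType) (u v c u' v' c' : R) :
  vec3 u v c = vec3 u' v' c' -> [/\ u = u', v = v' & c = c'].
Proof.
move=> H; have E i : vec3 u v c 0 i = vec3 u' v' c' 0 i by rewrite H.
by move: (E 0) (E 1) (E 2); rewrite !vec3E.
Qed.

Lemma vec3_mul (R : comNzRingType) (u v c u' v' c' : R) :
  ((vec3 u v c : heis R) * (vec3 u' v' c' : heis R))%g =
  vec3 (u + u') (v + v') (c + c' - u' * v) :> heis R.
Proof. by rewrite -[LHS]/(heis_mul _ _) /heis_mul !vec3E. Qed.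

Lemma vec3_inv (R : comNzRingType) (u v c : R) :
  ((vec3 u v c : heis R)^-1)%g = vec3 (- u) (- v) (- c - u * v) :> heis R.
Proof. by rewrite -[LHS]/(heis_inv _) /heis_inv !vec3E. Qed.

Lemma heis_dilation3E (R : comNzRingType) (u v c : R) :
  heis_dilation3 (vec3 u v c : heis R) = vec3 (3 * u) (3 * v) (9 * c).
Proof. by rewrite /heis_dilation3 /dilation3 !vec3E. Qed.

Lemma heis_intP (g : heis int) : exists u v c : int, g = vec3 u v c.
Proof. by exists (g 0 0), (g 0 1), (g 0 2); rewrite vec3P. Qed.

Lemma dilation3_twist (p q r u v c : int) :
  let g : heis int := vec3 p q r in
  (g * (vec3 u v c : heis int) * (heis_dilation3 g)^-1)%g =
  vec3 (u - 2 * p) (v - 2 * q)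
    (c - 8 * r - u * q - 6 * p * q + 3 * p * v) :> heis int.
Proof.
by rewrite /= heis_dilation3E vec3_inv !vec3_mul; congr vec3; rewrite ?vec3E; ring.
Qed.

(** * The 32 twisted conjugacy classes of the lattice *)

Section ConjugateDilation.
Variables (h : heis int) (phi : {ghom heis int -> heis int}).
Hypothesis phiE : forall g : heis int, (phi g = h * heis_dilation3 g * h^-1)%g.

(** Right translation by h^-1 carries the classes of the dilation to those of [phi], so computations
    involve the dilation alone. *)
Definition shifted_class (b : heis int) : reidemeister phi :=
  rclass phi (b * h^-1)%g.

Lemma shifted_class_surj alpha : exists b, shifted_class b = alpha.
Proof.
have [a <-] := rclass_surj alpha.
by exists (a * h)%g; rewrite /shifted_class mulgK.
Qed.

Lemma shifted_classP (a b : heis int) : shifted_class a = shifted_class b <->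
  exists g, (b = g * a * (heis_dilation3 g)^-1)%g.
Proof.
split=> [/rclassP[g gE]|[g gE]]; last apply/rclassP; exists g.
  rewrite -[b](mulgVK h) gE phiE !invgM invgK !mulgA.
  by rewrite mulgVK mulgVK.
by rewrite gE phiE !invgM invgK !mulgA mulgVK.
Qed.

Definition class_rep (t : 'I_2 * 'I_2 * 'I_8) : heis int :=
  vec3 (t.1.1)%:Z (t.1.2)%:Z (t.2)%:Z.

Lemma int_euclid (n : nat) (z : int) : (0 < n)%N ->
  exists (i : 'I_n) (k : int), z - n%:Z * k = i%:Z.
Proof.
move=> n0; have lt_n : (`|(z %% n%:Z)%Z| < n)%N by lia.
by exists (Ordinal lt_n), (z %/ n%:Z)%Z => /=; lia.
Qed.

Lemma class_rep_inj : injective (shifted_class \o class_rep).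
Proof.
move=> [[u v] c] [[u' v'] c'] /= /shifted_classP[g].
have [p [q [r ->]]] := heis_intP g.
rewrite dilation3_twist => /vec3_inj[/= e1 e2 e3].
move: (ltn_ord u) (ltn_ord v) (ltn_ord c) (ltn_ord u') (ltn_ord v') (ltn_ord c').
(* Elements of {0, 1} that differ by an even number agree, so only the shift by 8 r is left. *)
move=> *; have p0 : p = 0 by lia.
have q0 : q = 0 by lia.
by congr (_, _, _); apply/val_inj => /=; move: e1 e2 e3; rewrite p0 q0; lia.
Qed.

Lemma class_rep_surj alpha : exists t, shifted_class (class_rep t) = alpha.
Proof.
have [b <-] := shifted_class_surj alpha.
have [u [v [c ->]]] := heis_intP b.
have [i [p ip]] := @int_euclid 2 u isT.
have [j [q jq]] := @int_euclid 2 v isT.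
(* Division by 8 of the third coordinate obtained after twisting by (p, q, 0). *)
have [k [r kr]] :=
  @int_euclid 8 (c - u * q - 6 * p * q + 3 * p * v) isT.
exists (i, j, k); apply/esym/shifted_classP; exists (vec3 p q r).
rewrite dilation3_twist /class_rep /= -ip -jq -kr; congr vec3; ring.
Qed.

Lemma card_reidemeister_dilation3 :
  finite_set [set: reidemeister phi] /\
  #|` fset_set [set: reidemeister phi]| = 32%N.
Proof.
have fT : finite_set [set: 'I_2 * 'I_2 * 'I_8] by exact: finite_finset.
have [fR le_R] := card_fset_setT_le fT class_rep_surj.
split=> //; apply/eqP; rewrite eqn_leq.
have := card_fset_setT_ge fR class_rep_inj; move: le_R.
by rewrite card_fset_setT !card_prod !card_ord => -> ->.
Qed.

(** * Bounds for an arbitrary finite observer *)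

Section Observer.
Variable N : finite_observer phi.

(** In an abelian quotient conjugation by [h] disappears, so the dilation induces the identity. This
    kills (2u, 0, 0) and (0, 2v, 0), commutativity kills the center, and only the parities of u and
    v remain. *)
Lemma index_le4_of_abelian :
  (forall x y : quotient_group N, x * y = y * x)%g ->
  (forall x, observed_map x = x :> quotient_group N) ->
  (observer_index N <= 4)%N.
Proof.
move=> Qab Qid.
pose q := qproj N.
have q3 (u v c : int) :
    q (vec3 (3 * u) (3 * v) (9 * c) : heis int) = q (vec3 u v c).
  rewrite -heis_dilation3E -[RHS]Qid observed_mapE phiE.
  rewrite !(qprojM, qprojV) Qab mulgA.
  by rewrite mulVg mul1g.
have qU (u : int) : q (vec3 (2 * u) 0 0 : heis int) = 1%g.
  apply: (mulgI (q (vec3 u 0 0))); rewrite mulg1 -qprojM vec3_mul.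
  by rewrite -[RHS]q3; congr (q (vec3 _ _ _)); rewrite ?vec3E; ring.
have qV (v : int) : q (vec3 0 (2 * v) 0 : heis int) = 1%g.
  apply: (mulgI (q (vec3 0 v 0))); rewrite mulg1 -qprojM vec3_mul.
  by rewrite -[RHS]q3; congr (q (vec3 _ _ _)); rewrite ?vec3E; ring.
(* The central element (0, 0, c) is the discrepancy between the two products of (0, 1, 0) and (c, 0,
   0). *)
have qC (c : int) : q (vec3 0 0 c : heis int) = 1%g.
  apply: (mulgI (q ((vec3 0 1 0 : heis int) * (vec3 c 0 0 : heis int))%g)).
  rewrite mulg1 -qprojM [RHS]qprojM Qab -qprojM !vec3_mul.
  by congr (q (vec3 _ _ _)); rewrite ?vec3E; ring.
pose f (t : 'I_2 * 'I_2) := q (vec3 (t.1)%:Z (t.2)%:Z 0 : heis int).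
have fsurj x : exists t, f t = x.
  rewrite -(qreprK x); have [u [v [c ->]]] := heis_intP (qrepr x).
  have [i [k ik]] := @int_euclid 2 u isT.
  have {}ik : u = i%:Z + 2 * k by rewrite -ik; ring.
  have [j [l jl]] := @int_euclid 2 v isT.
  have {}jl : v = j%:Z + 2 * l by rewrite -jl; ring.
  exists (i, j); rewrite /f /= -/q.
  have -> : vec3 u v c = ((vec3 i%:Z j%:Z 0 : heis int) *
      (vec3 (2 * k) 0 0 : heis int) * (vec3 0 (2 * l) 0 : heis int) *
      (vec3 0 0 (c + 2 * k * j%:Z) : heis int))%g :> heis int.
    by rewrite !vec3_mul ik jl; congr vec3; rewrite ?vec3E; ring.
  by rewrite /q !qprojM -/q qU qV qC !mulg1.
have fT : finite_set [set: 'I_2 * 'I_2] by exact: finite_finset.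
have [_] := card_fset_setT_le fT fsurj.
by rewrite card_fset_setT card_prod !card_ord.
Qed.

Lemma card_observed_classes_le :
  let r := #|` fset_set [set: reidemeister (@observed_map _ phi N)]| in
  (r <= 4)%N \/ (8 * r <= 5 * observer_index N)%N.
Proof.
move=> r; have fN := observer_finite N.
have [] := card_reidemeister_le (@observed_map _ phi N) fN.
- by rewrite -/r -/(observer_index N) => ?; right; lia.
- by rewrite -/r -/(observer_index N) => ?; right.
- move=> [Qab Qid]; left; apply: leq_trans (index_le4_of_abelian Qab Qid).
  by have [] := card_fset_setT_le fN (@rclass_surj _ (@observed_map _ phi N)).
Qed.

End Observer.

(** * The observer of elements with even coordinates *)

Definition even_heis : set (heis int) :=
  [set x | exists u v c : int, x = vec3 (2 * u) (2 * v) (2 * c)].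

Lemma even_heis1 : even_heis 1%g.
Proof. by exists 0, 0, 0; rewrite mulr0. Qed.

Lemma even_heisM x y : even_heis x -> even_heis y -> even_heis (x * y)%g.
Proof.
move=> [u [v [c ->]]] [u' [v' [c' ->]]]; exists (u + u'), (v + v').
by exists (c + c' - 2 * u' * v); rewrite vec3_mul; congr vec3; ring.
Qed.

Lemma even_heisV x : even_heis x -> even_heis (x^-1)%g.
Proof.
move=> [u [v [c ->]]]; exists (- u), (- v), (- c - 2 * u * v).
by rewrite vec3_inv; congr vec3; ring.
Qed.

Lemma even_heisJ x g : even_heis x -> even_heis (g * x * g^-1)%g.
Proof.
move=> [u [v [c ->]]]; have [p [q [r ->]]] := heis_intP g.
exists u, v, (c + p * v - u * q).
by rewrite vec3_inv !vec3_mul; congr vec3; rewrite ?vec3E; ring.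
Qed.

Definition even_subgroup : normal_subgroup (heis int) :=
  NormalSubgroup even_heis1 even_heisM even_heisV even_heisJ.

Lemma even_quotient :
  finite_set [set: quotient_group even_subgroup] /\
  (#|` fset_set [set: quotient_group even_subgroup]| <= 8)%N.
Proof.
pose f (t : 'I_2 * 'I_2 * 'I_2) := qproj even_subgroup
  (vec3 (t.1.1)%:Z (t.1.2)%:Z (t.2)%:Z : heis int).
have fsurj x : exists t, f t = x.
  rewrite -(qreprK x); have [u [v [c ->]]] := heis_intP (qrepr x).
  have [i [p ip]] := @int_euclid 2 u isT.
  have [j [q jq]] := @int_euclid 2 v isT.
  have [k [r kr]] := @int_euclid 2 c isT.
  exists (i, j, k); apply/qprojP; exists p, q, (r + p * j%:Z).
  have -> : u = i%:Z + 2 * p by rewrite -ip; ring.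
  have -> : v = j%:Z + 2 * q by rewrite -jq; ring.
  have -> : c = k%:Z + 2 * r by rewrite -kr; ring.
  by rewrite vec3_inv vec3_mul; congr vec3; ring.
have fT : finite_set [set: 'I_2 * 'I_2 * 'I_2] by exact: finite_finset.
have := card_fset_setT_le fT fsurj.
by rewrite card_fset_setT !card_prod !card_ord.
Qed.

Lemma even_stable x : nsub even_subgroup x -> nsub even_subgroup (phi x).
Proof.
move=> [u [v [c ->]]]; rewrite phiE; apply: nsubJ.
exists (3 * u), (3 * v), (9 * c); rewrite heis_dilation3E; congr vec3; ring.
Qed.

Definition even_observer : finite_observer phi :=
  FiniteObserver (proj1 even_quotient) even_stable.

(** As 3 and 9 are odd, the dilation acts trivially on this quotient, a dihedral group of order 8;
    up to translation these are its five conjugacy classes. The general bound gives at most five,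
    explicit representatives at least five. *)
Lemma card_even_classes :
  #|` fset_set [set: reidemeister (@observed_map _ phi even_observer)]| = 5%N.
Proof.
set C := reidemeister _.
have fN := observer_finite even_observer.
have [fC _] :=
  card_fset_setT_le fN (@rclass_surj _ (@observed_map _ phi even_observer)).
apply/eqP; rewrite eqn_leq; apply/andP; split.
  have [|] := card_observed_classes_le even_observer.
    by move/leq_trans; apply.
  have := proj2 even_quotient; rewrite -/(observer_index even_observer) -/C; lia.
(* [Some (i, j)] records the parities of the first two coordinates; [None] is the nontrivial central
   element. *)
pose rep (t : option (bool * bool)) : heis int :=
  if t is Some (i, j) then vec3 (i%:Z) (j%:Z) 0 else vec3 0 0 1.
have -> : 5%N = #|{: option (bool * bool)}|.
  by rewrite card_option card_prod card_bool.
apply: (@card_fset_setT_ge _ _ (fun t =>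
  @observer_map _ phi even_observer (shifted_class (rep t))) fC).
(* Conjugating by h^-1 turns the relation for [phi] into one for the dilation. *)
move=> s t /observer_map_eqP[g] /(nsubJ h^-1%g).
set y := (X in nsub _ X -> _).
have -> : y = ((g * rep s * (heis_dilation3 g)^-1)^-1 * rep t)%g.
  rewrite /y phiE !invgM !invgK !mulgA mulVg mul1g.
  by rewrite !mulgVK.
have [p [q [r ->]]] := heis_intP g; set x := (_ / _)%g => -[u [v [c e]]].
have {e} : rep t = (x * (vec3 (2 * u) (2 * v) (2 * c) : heis int))%g.
  by rewrite -e mulVKg.
rewrite {}/x {y}.
(* The parities of the first two coordinates are invariant and, when both are even, so is the parity
   of the third. *)
case: s t => [[i j]|] [[i' j']|] //=; rewrite dilation3_twist vec3_mul.
- by move=> /vec3_inj[e1 e2 _]; congr (Some (_, _)); lia.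
- by move=> /vec3_inj[e1 e2 e3]; lia.
- by move=> /vec3_inj[e1 e2 e3]; lia.
Qed.

(** * Values of the profile and comparison with staircases *)

Variable RT : reidemeister phi -> int.
Hypothesis RT_N1 : forall alpha, RT alpha = -1.

Let finR := proj1 card_reidemeister_dilation3.

Lemma supp_card_N1 : supp_card RT = 32%N.
Proof.
rewrite /supp_card (_ : supp RT = [set: reidemeister phi]).
  exact: proj2 card_reidemeister_dilation3.
by apply/seteqP; split=> // alpha _; rewrite /supp /= RT_N1.
Qed.

Lemma visible_even : visible_class_count even_observer RT = 5%N.
Proof. by rewrite visible_class_count_N1 // card_even_classes. Qed.

Lemma visibility_profile8 : visibility_profile RT 8 = 5%N.
Proof.
apply: nat_max_eq => [|_ [N le8 ->]].
  by exists even_observer; [exact: proj2 even_quotient | rewrite visible_even].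
by rewrite visible_class_count_N1 //; have := card_observed_classes_le N; lia.
Qed.

Lemma visibility_profile5_le : (visibility_profile RT 5 <= 4)%N.
Proof.
apply: nat_max_le => _ [N le5 ->].
by rewrite visible_class_count_N1 //; have := card_observed_classes_le N; lia.
Qed.

Lemma profile_not_staircase :
  ~ (exists2 D : nat, (0 < D)%N & forall B : nat, (0 < B)%N ->
       visibility_profile RT B = divisor_staircase D B).
Proof.
move=> [D D0 profE].
(* The divisor 1 makes the range nonempty, so the maximum is attained by an actual divisor rather
   than being the default 0. *)
have D_gt0 : (0 < #|[pred d : 'I_9 | (d %| D)%N]|)%N.
  by apply/card_gt0P; exists (inord 1); rewrite inE /= inordK // dvd1n.
have [d dD bigE] := eq_bigmax_cond (fun d : 'I_9 => nat_of_ord d) D_gt0.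
rewrite inE in dD.
have d5 : d = 5%N :> nat.
  by rewrite -[LHS]bigE -[RHS]visibility_profile8 profE.
have := visibility_profile5_le; rewrite profE // leqNgt => /negP; apply.
apply: (@leq_bigmax_cond _ (fun d : 'I_6 => (d %| D)%N)
  (fun d : 'I_6 => nat_of_ord d) ord_max).
by rewrite /= -d5.
Qed.

End ConjugateDilation.

(** * Lifts and fixed-point indices *)

Lemma int_dist_lt1 (R : numDomainType) (m n : int) :
  `|m%:~R - n%:~R : R| < 1 -> m = n.
Proof. by rewrite -rmorphB -intr_norm ltrz1; lia. Qed.

Section Lifts.
Context {R : realType}.
Implicit Types (g : 'rV[R]_3 -> 'rV[R]_3) (z : 'rV[R]_3) (a b : heis int).

(* the coordinates of [g z * (dilation3 z)^-1] in the real Heisenberg group *)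
Definition deck_coord g (z : 'rV[R]_3) : 'I_3 -> R := fun i =>
  let k1 := g z 0 1 - 3 * z 0 1 in
  [:: g z 0 0 - 3 * z 0 0; k1; g z 0 2 - 9 * z 0 2 + 3 * z 0 0 * k1]`_i.

Lemma deck_coordE g z a : g z = deck a (dilation3 z) ->
  forall i, deck_coord g z i = (a 0 i)%:~R.
Proof.
move=> gz i; rewrite /deck_coord gz deckE /dilation3 !vec3E.
case: i => -[|[|[|//]]] Hi /=; rewrite ?vec3E.
- have -> : Ordinal Hi = 0 by exact/val_inj. by ring.
- have -> : Ordinal Hi = 1 by exact/val_inj. by ring.
- have -> : Ordinal Hi = 2 by exact/val_inj. by ring.
Qed.

Lemma deck_coord_continuous g z i :
  {for z, continuous g} -> {for z, continuous (deck_coord g ^~ i)}.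
Proof.
move=> gz.
have gc j : {for z, continuous (fun y => g y 0 j)}.
  apply: (@continuous_comp _ _ _ g (fun y : 'rV[R]_3 => y 0 j)) => //.
  exact: coord_continuous.
have cc j : {for z, continuous (fun y : 'rV[R]_3 => y 0 j)}.
  exact: coord_continuous.
have k1 : {for z, continuous (fun y => g y 0 1 - 3 * y 0 1)}.
  by apply: continuousB => //; apply: continuousM => //; exact: cst_continuous.
rewrite /deck_coord; case: i => -[|[|[|//]]] Hi /=.
- by apply: continuousB => //; apply: continuousM => //; exact: cst_continuous.
- by [].
- apply: continuousD; last first.
    by apply: continuousM => //; apply: continuousM => //; exact: cst_continuous.
  by apply: continuousB => //; apply: continuousM => //; exact: cst_continuous.
Qed.

Lemma lift_deck g z : M1_proj (g z) = F31 (M1_proj z) ->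
  exists a, g z = deck a (dilation3 z).
Proof. by rewrite F31E => /esym/M1_projP. Qed.

(** The deck coordinates take integer values near [z] and are continuous at [z], so they agree there
    with their value at [z]. *)
Lemma lift_local g z : {for z, continuous g} ->
  (\forall y \near z, M1_proj (g y) = F31 (M1_proj y)) ->
  exists a, \forall y \near z, g y = deck a (dilation3 y).
Proof.
move=> gz pg; have [a ga] := lift_deck (nbhs_singleton pg).
exists a; near=> y.
have [b gb] : exists b, g y = deck b (dilation3 y).
  by apply: lift_deck; near: y.
suff -> : a = b by [].
apply/rowP => i; apply: (@int_dist_lt1 R).
rewrite -(deck_coordE ga) -(deck_coordE gb).
have : forall i, `|deck_coord g z i - deck_coord g y i| < 1.
  near: y; apply: filter_forall => j.
  by apply: cvgr_dist_lt => //; exact: deck_coord_continuous.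
by apply.
Unshelve. all: by end_near. Qed.

(** By the intermediate value theorem, a change of value would force a half-integer value. *)
Lemma continuous_int_valued (f : R -> R) : continuous f ->
  (forall t, exists m : int, f t = m%:~R) -> forall s t, f s = f t.
Proof.
move=> fc fZ.
suff H s t : s <= t -> f s = f t.
  by move=> s t; have [/H//|/ltW/H] := leP s t.
move=> st; have [m fm] := fZ s; have [n fn] := fZ t.
have halfN (k l : int) : k%:~R + 2^-1 <> l%:~R :> R.
  move=> kl; have /(@intr_inj R) : (2 * k + 1)%:~R = (2 * l)%:~R :> R.
    by rewrite rmorphD !rmorphM /= -kl; field.
  lia.
have between : forall k l : int, (k < l)%R ->
    ((k%:~R : R) <= (k%:~R + 2^-1 : R)) && ((k%:~R + 2^-1 : R) <= (l%:~R : R)).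
  move=> k l kl; have : ((k + 1)%:~R : R) <= l%:~R by rewrite ler_int; lia.
  clear kl; rewrite intrD => kl1; apply/andP; split; lra.
have no_mid (k : int) :
    ~ (Num.min (f s) (f t) <= k%:~R + 2^-1 <= Num.max (f s) (f t)).
  move=> /(IVT st (continuous_subspaceT fc))[c _].
  by have [l ->] := fZ c => /esym/halfN.
rewrite fm fn in no_mid *; have [mn|nm|-> //] := ltgtP m n; exfalso.
- by apply: (no_mid m); rewrite min_l ?max_r ?ler_int ?(ltW mn) // between.
- by apply: (no_mid n); rewrite min_r ?max_l ?ler_int ?(ltW nm) // between.
Qed.

(** Along the line through 0 and [y] the deck coordinates are continuous and integer valued, so the
    deck transformation found at 0 serves at [y] too. *)
Lemma lift_rigid g : continuous g ->
  (forall y, M1_proj (g y) = F31 (M1_proj y)) ->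
  exists a, forall y, g y = deck a (dilation3 y).
Proof.
move=> gc pg; have [a ga] := lift_deck (pg 0); exists a => y.
have [b gb] := lift_deck (pg y).
suff -> : a = b by [].
apply/rowP => i; apply: (@intr_inj R).
rewrite -(deck_coordE ga) -(deck_coordE gb).
rewrite -[y in RHS]scale1r -[0 in LHS](scale0r y).
apply: (@continuous_int_valued (fun t : R => deck_coord g (t *: y) i)) => t.
  apply: (@continuous_comp _ _ _ (fun t : R => t *: y) (deck_coord g ^~ i)).
    exact: scalel_continuous.
  by apply: deck_coord_continuous; exact: gc.
by have [c gc'] := lift_deck (pg (t *: y)); exists (c 0 i); exact: deck_coordE.
Qed.

End Lifts.

(** * Fixed-point index of a locally affine map *)

Section AffineIndex.
Context {R : realType}.

Lemma near_affine_diff (V W : normedModType R) (f : V -> W)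
    (df : {linear V -> W}) x : continuous df ->
    (\forall z \near x, f z = f x + df (z - x)) ->
  differentiable f x /\ 'd f x = df :> (V -> W).
Proof.
move=> dfc fE.
have E : f \o shift x = cst (f x) + df +o_ 0 id.
  apply/eqaddoP => _/posnumP[e].
  move: fE; rewrite (near_shift 0) /= => fE; near=> k.
  have : f (k + (x - 0)) = f x + df (k + (x - 0) - x) by near: k.
  rewrite subr0 addrK => kE.
  rewrite -[X in `|X|]/(f (k + x) - (f x + df k)) kE subrr normr0.
  by rewrite mulr_ge0.
have dE := diff_unique dfc E.
by split=> //; apply/diff_locallyP; split; rewrite dE.
Unshelve. all: by end_near. Qed.

Lemma sum_continuous (T : topologicalType) (V : normedModType R) (I : Type)
    (s : seq I) (F : I -> T -> V) : (forall i, continuous (F i)) ->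
  continuous (fun x => \sum_(i <- s) F i x).
Proof.
move=> Fc; elim: s => [|i s IHs] x.
  by under eq_fun do rewrite big_nil; exact: cst_continuous.
under eq_fun do rewrite big_cons.
by apply: continuousD; [exact: Fc | exact: IHs].
Qed.

Lemma mulmxr_continuous n (M : 'M[R]_n) :
  continuous (fun y : 'rV[R]_n => y *m M).
Proof.
under eq_fun do rewrite mulmx_sum_row.
apply: sum_continuous => i y.
apply: (@continuous_comp _ _ _ (fun z : 'rV[R]_n => z 0 i)
  (fun t : R => t *: row i M)).
  exact: coord_continuous.
exact: scalel_continuous.
Qed.

Lemma near_affine_jacobian n (f : 'rV[R]_n -> 'rV[R]_n) (M : 'M[R]_n) x :
    (\forall z \near x, f z = f x + (z - x) *m M) ->
  differentiable f x /\ 'J f x = M.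
Proof.
move=> /(near_affine_diff (df := mulmxr M) (@mulmxr_continuous n M)) [fx dE].
split=> //; apply/row_matrixP => i; rewrite !rowE /jacobian mul_rV_lin1 dE.
by [].
Qed.

(** On small balls id - g is an invertible linear map centered at [x], so [x] is its only zero, a
    regular one, and the degree is the sign of one Jacobian. *)
Lemma euclidean_index_affine n (g : 'rV[R]_n -> 'rV[R]_n) (M : 'M[R]_n)
    (x : 'rV[R]_n) :
    \det M != 0 -> (\forall y \near x, y - g y = (y - x) *m M) ->
  euclidean_index g x = sgz (\det M).
Proof.
move=> detM /nbhs_ballP[r /= r0 gE]; pose h y := y - g y.
have hE (y : 'rV[R]_n) : ball x r y -> h y = (y - x) *m M by move=> /gE.
have hJ y : ball x r y -> differentiable h y /\ 'J h y = M.
  move=> xry; apply: near_affine_jacobian; near=> z.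
  rewrite !hE //; last first.
    by near: z; exact: (open_nbhs_nbhs (conj (ball_open x r) xry)).
  by rewrite -mulmxDl [X in _ = X *m _]addrC subrKA.
have xrx : ball x r x by exact: ballxx.
have hx : h x = 0 by rewrite hE // subrr mul0mx.
have h0 y : ball x r y -> h y = 0 -> y = x.
  move=> xry; rewrite hE // => /(congr1 (mulmx^~ (invmx M))).
  by rewrite mulmxK ?unitmxE ?unitfE // mul0mx => /subr0_eq.
have degE e : 0 < e -> e < r -> brouwer_degree h (ball x e) = sgz (\det M).
  move=> e0 er.
  have sub y : closure (ball x e) y -> ball x r y by exact: closed_ball_subset.
  have sub' y : ball x e y -> ball x r y by move=> /subset_closure/sub.
  have reg : zero_regular h (ball x e).
    split.
    - apply: continuous_in_subspaceT => y /set_mem/sub/hJ[hy _].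
      exact: differentiable_continuous.
    - move=> y /[dup] xey /sub' xry; have [hy hJy] := hJ y xry; split=> //.
      apply: (@cvg_near_cst _ _ ('J h y) (jacobian h) (nbhs y)); near=> z.
      rewrite hJy; apply: (hJ z _).2; near: z.
      exact: (open_nbhs_nbhs (conj (ball_open x r) xry)).
    - move=> y [/sub xry yNi]; apply/eqP => /(h0 _ xry) yx; apply: yNi.
      by rewrite yx; exact: nbhsx_ballx.
    - by move=> y /sub' xry _; rewrite (hJ y xry).2.
  have zeros : [set y | ball x e y /\ h y = 0] = [set x].
    apply/seteqP; split=> [y [/sub' xry /(h0 _ xry)]//|_ ->].
    by split=> //; exact: ballxx.
  have -> : brouwer_degree h (ball x e) = regular_degree h (ball x e).
    by rewrite /brouwer_degree; case: (pselect (zero_regular h (ball x e))).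
  by rewrite /regular_degree zeros fsbig_set1 (hJ x xrx).2.
have near_deg : \forall e \near 0^'+,
    brouwer_degree h (ball x e) = sgz (\det M).
  near=> e; apply: degE; near: e; [exact: nbhs_right_gt | exact: nbhs_right_lt].
(* The filter of small positive radii is proper, so two eventual values of the degree agree at a
   common radius. *)
apply: xget_unique => //= d degd.
have : \forall e \near 0^'+, brouwer_degree h (ball x e) = d /\
    brouwer_degree h (ball x e) = sgz (\det M) by exact: filterI.
by move=> /filter_ex[e [<-]].
Unshelve. all: by end_near. Qed.

End AffineIndex.

(** * Fixed points of the lifts and the Reidemeister trace *)

Section FixedPoints.
Context {R : realType}.
Implicit Types (x y z : 'rV[R]_3) (a b : heis int).

Lemma deck_inj x : injective (fun a => deck a x).
Proof.
move=> a b; rewrite !deckE => /vec3_inj[/addIr/intr_inj e0 /addIr/intr_inj e1].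
rewrite e1 => /addIr/addIr/intr_inj e2.
by rewrite -(vec3P a) -(vec3P b) e0 e1 e2.
Qed.

(** The linear part of y - a D(y), acting on row vectors from the right; the off-diagonal entry
    comes from the term u'v of the group law. *)
Definition id_sub_deck_mx a : 'M[R]_3 :=
  \matrix_i [:: vec3 (-2) 0 (3 * (a 0 1)%:~R); vec3 0 (-2) 0; vec3 0 0 (-8)]`_i.

Lemma det_id_sub_deck a : \det (id_sub_deck_mx a) = - 32.
Proof.
rewrite -det_tr det_trig; last first.
  apply/is_trig_mxP => -[[|[|[|//]]] Hi] [[|[|[|//]]] Hj] //= _;
    by rewrite !mxE.
rewrite !big_ord_recl big_ord0 !mxE /= ; ring.
Qed.

Lemma deck_dilation3_sub a x y :
  deck a (dilation3 x) = x ->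
  y - deck a (dilation3 y) = (y - x) *m id_sub_deck_mx a.
Proof.
move=> ax; have -> : y - deck a (dilation3 y) =
    (y - deck a (dilation3 y)) - (x - deck a (dilation3 x)).
  by rewrite ax subrr subr0.
apply/rowP => j; rewrite !deckE /dilation3 !mxE !big_ord_recl big_ord0 !mxE /=.
have -> : lift ord0 (lift ord0 ord0) = 2 :> 'I_3 by exact/val_inj.
have -> : lift ord0 ord0 = 1 :> 'I_3 by exact/val_inj.
case: j => -[|[|[|//]]] Hj /=.
- by rewrite (_ : Ordinal Hj = 0); [ring | exact/val_inj].
- by rewrite (_ : Ordinal Hj = 1); [ring | exact/val_inj].
- by rewrite (_ : Ordinal Hj = 2); [ring | exact/val_inj].
Qed.

Lemma deck_dilation3_fixed a :
  exists x, [set y | deck a (dilation3 y) = y] = [set x].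
Proof.
set u : R := (a 0 0)%:~R; set v : R := (a 0 1)%:~R; set c : R := (a 0 2)%:~R.
(* The system is triangular: the first coordinate is solved and substituted into the equation of the
   third. *)
exists (vec3 (- u / 2) (- v / 2) ((3 * (- u / 2) * v - c) / 8)).
apply/seteqP; split=> [y /=|y ->] /=.
  rewrite -(vec3P y) deckE /dilation3 !vec3E -/u -/v -/c => /vec3_inj[e0 e1 e2].
  have y0 : y 0 0 = - u / 2 by lra.
  by rewrite y0 in e2 *; congr vec3; lra.
rewrite deckE /dilation3 !vec3E -/u -/v -/c; congr vec3; lra.
Qed.

(** [fixed_point_index] ranges over all points of the fiber and all local lifts there; each lift
    agrees near its fixed point with some b D, whose index is the sign of -32. *)
Lemma fixed_point_index_F31 a x : deck a (dilation3 x) = x ->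
  fixed_point_index (@M1_proj R) (@F31 R) (M1_proj x) = -1.
Proof.
have index_deck b y g : g y = y ->
    (\forall z \near y, g z = deck b (dilation3 z)) ->
    euclidean_index g y = -1.
  move=> gy gE; have fixy : deck b (dilation3 y) = y.
    by rewrite -(nbhs_singleton gE).
  have det32 := det_id_sub_deck b.
  rewrite (@euclidean_index_affine _ _ _ (id_sub_deck_mx b)).
  - by rewrite det32 sgzN gtr0_sgz // ltr0n.
  - by rewrite det32 oppr_eq0 pnatr_eq0.
  - by near=> z; rewrite -(deck_dilation3_sub z fixy); congr (_ - _); near: z.
move=> ax; have cont_a : continuous (fun z => deck a (dilation3 z)).
  pose M := id_sub_deck_mx a.
  have -> : (fun z => deck a (dilation3 z)) =
      (fun z : 'rV[R]_3 => z) - ((fun z : 'rV[R]_3 => z *m M) - (fun=> x *m M)).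
    apply/funext => z; rewrite -[RHS]/(z - (z *m M - x *m M)).
    by rewrite -mulmxBl -(deck_dilation3_sub z ax) opprB addrC subrK.
  move=> z; apply: continuousB; first exact: cvg_id.
  apply: continuousB; [exact: mulmxr_continuous | exact: cst_continuous].
apply: xget_unique => [|d [y [g [_ gy near_g ->]]]].
  exists x, (fun z => deck a (dilation3 z)); split=> //.
    near=> z; split; first exact: cont_a.
    by rewrite F31E; apply/esym/M1_projP; exists a.
  by rewrite (index_deck a) //; near=> z.
have [b gb] : exists b, \forall z \near y, g z = deck b (dilation3 z).
  apply: lift_local; first by have [] := nbhs_singleton near_g.
  near=> z.
  by have [] : {for z, continuous g} /\ M1_proj (g z) = F31 (M1_proj z) by near: z.
exact: index_deck gb.
Unshelve. all: by end_near. Qed.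

Variables (ft : 'rV[R]_3 -> 'rV[R]_3) (phi : {ghom heis int -> heis int}).
Variable h : heis int.
Hypothesis ftE : forall x, ft x = deck h (dilation3 x).

(** Both phi(g) h and h D(g) move D(0) to the same point, and the lattice acts freely. *)
Lemma lift_endomorphism : lift_compatible (@deck R) ft phi ->
  forall g : heis int, (phi g = h * heis_dilation3 g * h^-1)%g.
Proof.
move=> ft_phi g; apply: (mulIg h); rewrite mulgVK.
apply: (@deck_inj (dilation3 0)).
by rewrite /= !deckM -ftE -ft_phi ftE dilation3_deck.
Qed.

(** The class of [a] is the image of the unique fixed point of a h D, so the sum has a single
    term. *)
Lemma reidemeister_trace_N1 (alpha : reidemeister phi) :
  reidemeister_trace (@M1_proj R) (@deck R) (@F31 R) ft alpha = -1.
Proof.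
rewrite /reidemeister_trace /fixed_point_class; set a := rrepr alpha.
have [x fixE] := deck_dilation3_fixed (a * h)%g.
have -> : [set y | deck a (ft y) = y] = [set x].
  by rewrite -fixE; apply/seteqP; split=> y /=; rewrite deckM ftE.
rewrite image_set1 fsbig_set1; apply: (@fixed_point_index_F31 (a * h)%g).
by have : [set x] x by []; rewrite -fixE.
Qed.

End FixedPoints.

(** * Profile and Nielsen number computed from an arbitrary lift *)

Theorem proposition10p4 (R : realType)
    (ft : 'rV[R]_3 -> 'rV[R]_3) (phi : {ghom heis int -> heis int})
    (ft_lift : is_lift (@M1_proj R) (@F31 R) ft)
    (ft_phi : lift_compatible (@deck R) ft phi) :
  let RT := reidemeister_trace (@M1_proj R) (@deck R) (@F31 R) ft (phi := phi) in
  let NF := nielsen_number (@M1_proj R) (@deck R) (@F31 R) ft phi in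
  [/\ visibility_profile RT 8 = 5%N,
      NF = 32%N,
      exists N : finite_observer phi, ~~ (visible_class_count N RT %| NF)%N
    & ~ (exists2 D : nat, (0 < D)%N &
          forall B : nat, (0 < B)%N ->
            visibility_profile RT B = divisor_staircase D B)].
Proof.
move=> RT NF; have [h ftE] := lift_rigid ft_lift.1 ft_lift.2.
have phiE := lift_endomorphism ftE ft_phi.
have RT_N1 : forall alpha, RT alpha = -1 by exact: reidemeister_trace_N1 ftE.
have NF32 : NF = 32%N by exact: (supp_card_N1 phiE RT_N1).
split=> //.
- exact: (visibility_profile8 phiE RT_N1).
- by exists (even_observer phiE); rewrite visible_even // NF32.
- exact: (profile_not_staircase phiE RT_N1).
Qed.
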